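(* Let $(M,g)$ be a pseudo-Riemannian Einstein manifold of dimension $n\ge3$, let $k\in\mathbb{Z}_{>0}$, and let the operators act on smooth complex valued functions on $M$. Then $(\mu,f)$ is an eigenvalue, eigenfunction pair for the GJMS operator $P_k$ if and only if for some $m\in\{1,\ldots,k\}$ $$f=f_1+\cdots+f_m,\qquad0\ne f_i,\quad i=1,\ldots,m,$$ where, for each $i\in\{1,\ldots,m\}$, $(Y-\lambda_i)^{p_i}f_i=0$ and $\lambda_i\in\mathbb{C}$ is a multiplicity $p_i$ solution of the polynomial equation $P_k[x]-\mu=0$, with $\lambda_1,\ldots,\lambda_m$ mutually distinct. Here $P_k$ is considered as a polynomial in $Y$, i.e. $P_k[x]=\prod_{i=1}^{k}(x+b_i\mathrm{Sc})$ with $b_i=\frac{i(1-i)}{n(n-1)}$.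
   Context: Einstein means that the Ricci curvature is proportional to the metric; the scalar curvature $\mathrm{Sc}$ (metric trace of Ricci) is then constant. $\Delta=\delta d=\nabla^*\nabla$ is the positive energy Laplacian on functions. The conformal Laplacian is $Y=\Delta+\frac{n(n-2)}{4n(n-1)}\mathrm{Sc}$. On an Einstein manifold, for any $k\in\mathbb{Z}_{>0}$, the (order $2k$) GJMS operator means $$P_k=\prod_{i=1}^{k}(\Delta+c_i\mathrm{Sc}),\qquad c_i=\frac{(n+2i-2)(n-2i)}{4n(n-1)},$$ equivalently $P_k=\prod_{i=1}^{k}(Y+b_i\mathrm{Sc})$. $(\mu,f)$ is an eigenvalue, eigenfunction pair if $\mu\in\mathbb{C}$, $f\ne0$ is smooth and $P_kf=\mu f$. *)

(* Defs.v *)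
From HB Require Import structures.
From mathcomp Require Import all_boot all_order all_algebra.
From mathcomp Require Import all_classical all_reals all_analysis.
From mathcomp Require Import complex.

Set Implicit Arguments.
Unset Strict Implicit.
Unset Printing Implicit Defensive.

Import Order.TTheory GRing.Theory Num.Theory.
Import numFieldNormedType.Exports.

Local Open Scope classical_set_scope.
Local Open Scope ring_scope.
Local Open Scope complex_scope.

Section Smoothness.
Context {R : realType} {n : nat}.

Definition pderiv {V : normedModType R} (i : 'I_n) (f : 'rV[R]_n -> V)
  : 'rV[R]_n -> V := fun y => 'D_(delta_mx 0 i) f y.

(* Meaningful for open [U] only: partial derivatives at a point of [U] use the
   values of [f] on a neighbourhood of that point. *)
Fixpoint Ck_on {V : normedModType R} (k : nat) (U : set 'rV[R]_n)
    (f : 'rV[R]_n -> V) : Prop :=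
  if k is k'.+1 then
    (forall y, U y -> differentiable f y) /\
    (forall i, Ck_on k' U (pderiv i f))
  else forall y, U y -> {for y, continuous f}.

Definition smooth_on {V : normedModType R} (U : set 'rV[R]_n)
    (f : 'rV[R]_n -> V) : Prop := forall k, Ck_on k U f.

End Smoothness.

(* A chart is a homeomorphism from the open set [dom] onto the open set
   [coord @` dom]; [coord] and its inverse [param] are total functions whose
   values elsewhere are irrelevant. *)
Record chart (R : realType) (n : nat) (M : topologicalType) := Chart {
  dom : set M;
  coord : M -> 'rV[R]_n;
  param : 'rV[R]_n -> M;
  open_dom : open dom;
  open_img : open (coord @` dom);
  paramK : forall x, dom x -> param (coord x) = x;
  coord_continuous : forall x, dom x -> {for x, continuous coord};
  param_continuous :
    forall y, (coord @` dom) y -> {for y, continuous param}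
}.

Definition transition (R : realType) (n : nat) (M : topologicalType)
    (a b : chart R n M) : 'rV[R]_n -> 'rV[R]_n :=
  fun y => coord b (param a y).

Record manifold (R : realType) (n : nat) := Manifold {
  space :> topologicalType;
  space_hausdorff : hausdorff_space space;
  space_second_countable : @second_countable space;
  atlas_index : Type;
  atlas : atlas_index -> chart R n space;
  atlas_cover : forall x : space, exists a, dom (atlas a) x;
  atlas_smooth : forall a b,
    smooth_on (coord (atlas a) @` (dom (atlas a) `&` dom (atlas b)))
      (transition (atlas a) (atlas b))
}.

(* [metric_mx g a y] is the matrix of the metric, in the coordinate frame of
   the chart [a], at the point with coordinates [y].  The signature is not
   prescribed: the matrices are symmetric and invertible.  The library's
   Jacobian acts on row vectors from the right, i.e. its entry (i, j) is the
   i-th partial derivative of the j-th component. *)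
Record pseudo_riemannian_metric (R : realType) (n : nat) (M : manifold R n) :=
  PseudoRiemannianMetric {
  metric_mx : atlas_index M -> 'rV[R]_n -> 'M[R]_n;
  metric_smooth : forall a,
    smooth_on (coord (atlas a) @` dom (atlas a)) (metric_mx a);
  metric_sym : forall a y, (coord (atlas a) @` dom (atlas a)) y ->
    (metric_mx a y)^T = metric_mx a y;
  metric_nondegenerate : forall a y, (coord (atlas a) @` dom (atlas a)) y ->
    metric_mx a y \in unitmx;
  metric_change : forall a b y,
    (coord (atlas a) @` (dom (atlas a) `&` dom (atlas b))) y ->
    let t := transition (atlas a) (atlas b) in
    metric_mx a y = 'J t y *m metric_mx b (t y) *m ('J t y)^T
}.

Section LocalGeometry.
Context {R : realType} {n : nat} (G : 'rV[R]_n -> 'M[R]_n).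
Implicit Types (i j k l m : 'I_n) (y : 'rV[R]_n).

Definition ginv i j y : R := invmx (G y) i j.

(* [christoffel k i j] is Gamma^k_{ij} of the Levi-Civita connection. *)
Definition christoffel k i j y : R :=
  2^-1 * \sum_l ginv k l y *
    (pderiv i (fun z => G z j l) y + pderiv j (fun z => G z i l) y
     - pderiv l (fun z => G z i j) y).

(* R(d_i, d_j) d_k = sum_l (riemann l k i j) d_l, where
   R(X, Y) = [nabla_X, nabla_Y] - nabla_[X, Y]. *)
Definition riemann l k i j y : R :=
  pderiv i (christoffel l j k) y - pderiv j (christoffel l i k) y
  + \sum_m (christoffel l i m y * christoffel m j k y
            - christoffel l j m y * christoffel m i k y).

Definition ricci_mx y : 'M[R]_n :=
  \matrix_(k, j) \sum_i riemann i k i j y.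

Definition local_scal y : R :=
  \sum_i \sum_j ginv i j y * ricci_mx y i j.

Definition hessian (u : 'rV[R]_n -> R) i j y : R :=
  pderiv i (pderiv j u) y - \sum_k christoffel k i j y * pderiv k u y.

(* The sign makes it the positive energy Laplacian: -tr_g(nabla du). *)
Definition local_laplacian (u : 'rV[R]_n -> R) y : R :=
  - \sum_i \sum_j ginv i j y * hessian u i j y.

End LocalGeometry.

Section GlobalGeometry.
Context {R : realType} {n : nat} (M : manifold R n)
        (g : pseudo_riemannian_metric M).

(* The local formulas below do not depend on the chart around [x]. *)
Definition chart_at (x : M) : atlas_index M := projT1 (cid (atlas_cover x)).

Definition einstein : Prop :=
  exists c : R, forall a y, (coord (atlas a) @` dom (atlas a)) y ->
    ricci_mx (metric_mx g a) y = c *: metric_mx g a y.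

Definition scal (x : M) : R :=
  let a := chart_at x in
  local_scal (metric_mx g a) (coord (atlas a) x).

Definition laplacianR (u : M -> R) (x : M) : R :=
  let a := chart_at x in
  local_laplacian (metric_mx g a) (u \o param (atlas a)) (coord (atlas a) x).

Definition smoothR (u : M -> R) : Prop :=
  forall a, smooth_on (coord (atlas a) @` dom (atlas a))
              (u \o param (atlas a)).

Definition re_part (f : M -> R[i]) (x : M) : R := complex.Re (f x).
Definition im_part (f : M -> R[i]) (x : M) : R := complex.Im (f x).

Definition smooth (f : M -> R[i]) : Prop :=
  smoothR (re_part f) /\ smoothR (im_part f).

Definition laplacian (f : M -> R[i]) (x : M) : R[i] :=
  laplacianR (re_part f) x +i* laplacianR (im_part f) x.

(* The operator Delta + c Sc, where Sc acts by pointwise multiplication. *)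
Definition laplacian_plus (c : R) (f : M -> R[i]) (x : M) : R[i] :=
  laplacian f x + (c * scal x)%:C * f x.

Definition conformal_laplacian : (M -> R[i]) -> (M -> R[i]) :=
  laplacian_plus ((n%:R * (n%:R - 2)) / (4 * n%:R * (n%:R - 1))).

Definition gjms_coef (i : nat) : R :=
  ((n%:R + 2 * i%:R - 2) * (n%:R - 2 * i%:R)) / (4 * n%:R * (n%:R - 1)).

Definition gjms (k : nat) : (M -> R[i]) -> (M -> R[i]) :=
  \big[(fun A B => A \o B)/id]_(1 <= i < k.+1) laplacian_plus (gjms_coef i).

Definition eigenpair (P : (M -> R[i]) -> (M -> R[i]))
    (mu : R[i]) (f : M -> R[i]) : Prop :=
  [/\ smooth f, exists x, f x != 0 & forall x, P f x = mu * f x].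

(* The operator Y - lambda. *)
Definition Y_minus (lambda : R[i]) (f : M -> R[i]) (x : M) : R[i] :=
  conformal_laplacian f x - lambda * f x.

End GlobalGeometry.

Section GJMSPolynomial.
Context {R : realType}.

Definition Y_coef (n i : nat) : R :=
  (i%:R * (1 - i%:R)) / (n%:R * (n%:R - 1)).

(* The polynomial P_k[x] for a scalar curvature with constant value [Sc]. *)
Definition gjms_poly (n k : nat) (Sc : R) : {poly R[i]} :=
  \prod_(1 <= i < k.+1) ('X + ((Y_coef n i * Sc)%:C)%:P).

Definition root_of_multiplicity (q : {poly R[i]}) (z : R[i]) (p : nat) : Prop :=
  root q z /\ mup z q = p.

End GJMSPolynomial.

(* Main.v *)
Require Import Defs.
From mathcomp Require Import all_boot all_order all_algebra.
From mathcomp Require Import all_classical all_reals all_analysis.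
From mathcomp Require Import complex.
From mathcomp Require Import ring lra.

Set Implicit Arguments.
Unset Strict Implicit.
Unset Printing Implicit Defensive.

Import Order.TTheory GRing.Theory Num.Theory.
Import numFieldNormedType.Exports.

Local Open Scope classical_set_scope.
Local Open Scope ring_scope.
Local Open Scope complex_scope.

(** The scalar curvature of an Einstein metric is constant, and the
coefficients satisfy c_i = n(n-2)/(4n(n-1)) + b_i, so the GJMS operator is the
polynomial P_k[Y] in the single operator Y ([gjms_poly_act]).  On the complex
vector space of smooth functions Y is a linear endomorphism, and P_k f = mu f
says that Q(Y) f = 0 for Q = P_k[x] - mu, a polynomial of degree k.  Over the
complex numbers Q is, up to a nonzero scalar, a product of powers
(x - lambda)^p of distinct linear factors.  These powers are pairwise coprime,
so Bezout's identity decomposes the kernel of Q(Y) as the direct sum of the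
kernels of the (Y - lambda)^p.  The nonzero components of f are the f_i; there
are at most k of them because Q has at most k roots, and directness of the sum
shows conversely that a sum of nonzero f_i is not zero.  This is
[generalized_eigenvector_decomposition], which holds in any vector space over
an algebraically closed field.

The components f_i are polynomials in Y applied to f, so everything rests on Y
preserving smoothness.  The Laplacian at x is computed in a chart chosen at x,
and the charts chosen at neighbouring points may be unrelated; hence the local
formula has to be shown independent of the chart ([local_laplacian_change]).
With J the Jacobian matrix of the change of coordinates t and Ga = J Gb J^T,
differentiating this relation gives the transformation law of the Christoffel
symbols, in which the second derivatives of t appear; since these are symmetric
([derive_sym]), they cancel exactly against those produced by the chain rule in
the second derivatives of a function.  So the Hessian transforms as a tensor,
Ha = J Hb J^T, and its trace against the inverse metric does not change. *)

(** * Calculus of C^k functions on an open set *)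

(** The difference [g - f] vanishes near [x], hence has differential [0]. *)
Lemma near_eq_differentiable (R : numFieldType) (V W : normedModType R)
    (f g : V -> W) (x : V) :
  (\near x, f x = g x) -> differentiable f x -> differentiable g x.
Proof.
move=> fg df.
pose h : V -> W := g - f.
have hx : h x = 0 by rewrite /h !fctE (nbhs_singleton fg) subrr.
have dh : h \o shift x = cst (h x) + (0 : V -> W) +o_ 0 id.
  apply/eqaddoP => _/posnumP[e].
  have : \forall y \near 0, f (y + x) = g (y + x).
    by rewrite (near_shift x) sub0r; near do rewrite /= subrK.
  move=> fgx; near=> y.
  rewrite !fctE /= hx /h !fctE.
  have -> : f (y + x) = g (y + x) by near: y.
  by rewrite subrr addr0 subr0 normr0 mulr_ge0.
have -> : g = f + h by rewrite /h addrC subrK.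
apply: differentiableD => //.
have c0 : continuous (0 : V -> W) by exact: cst_continuous.
have dh0 : 'd h x = 0 :> (V -> W) by apply/diff_unique.
by apply/diff_locallyP; rewrite dh0.
Unshelve. all: by end_near. Qed.

Section SmoothCalculus.
Context {R : realType} {n : nat} (U : set 'rV[R]_n) (openU : open U).

Lemma near_open (V : Type) (f g : 'rV[R]_n -> V) y : U y ->
  (forall z, U z -> f z = g z) -> \near y, f y = g y.
Proof.
move=> Uy fg; near=> z; apply: fg; near: z; exact: open_nbhs_nbhs.
Unshelve. all: by end_near. Qed.

Lemma pderiv_eq (V : normedModType R) (f g : 'rV[R]_n -> V) i :
  (forall z, U z -> f z = g z) -> forall z, U z -> pderiv i f z = pderiv i g z.
Proof. by move=> fg z Uz; apply: near_eq_derive; exact: near_open fg. Qed.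

(** [Ck_on k U f] constrains a total function [f] on [U] alone; as [U] is open,
this gives the freedom to replace a derivative by the expression that computes
it on [U], which is how all closure properties below are proved. *)
Lemma Ck_on_eq (V : normedModType R) k (f g : 'rV[R]_n -> V) :
  (forall z, U z -> f z = g z) -> Ck_on k U f -> Ck_on k U g.
Proof.
elim: k f g => [|k IH] f g fg /=.
  move=> cf y Uy; rewrite /prop_for /continuous_at -(fg _ Uy).
  apply: cvg_trans (cf y Uy).
  exact: (@near_eq_cvg _ _ (nbhs y) _ f g (near_open Uy fg)).
move=> [df dif]; split=> [y Uy|i].
  by apply: near_eq_differentiable (df _ Uy); exact: near_open fg.
by apply: IH (dif i); exact: pderiv_eq.
Qed.

Lemma Ck_onW (V : normedModType R) k (f : 'rV[R]_n -> V) :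
  Ck_on k.+1 U f -> Ck_on k U f.
Proof.
elim: k f => [|k IH] f [df dif].
  by move=> y Uy; apply/differentiable_continuous/df.
by split=> // i; apply/IH/dif.
Qed.

Lemma Ck_on_cst (V : normedModType R) k (c : V) : Ck_on k U (fun=> c).
Proof.
elim: k c => [|k IH] c; first by move=> y _; exact: cst_continuous.
split=> [y _|i]; first exact: differentiable_cst.
by apply: Ck_on_eq (IH 0) => z _; rewrite /pderiv derive_cst.
Qed.

Lemma Ck_onD (V : normedModType R) k (f g : 'rV[R]_n -> V) :
  Ck_on k U f -> Ck_on k U g -> Ck_on k U (fun y => f y + g y).
Proof.
elim: k f g => [|k IH] f g /=.
  by move=> cf cg y Uy; exact: continuousD (cf _ Uy) (cg _ Uy).
move=> [df dif] [dg dig]; split=> [y Uy|i].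
  exact: differentiableD (df _ Uy) (dg _ Uy).
apply: Ck_on_eq (IH _ _ (dif i) (dig i)) => z Uz.
by rewrite /pderiv deriveD//; apply: diff_derivable; [exact: df|exact: dg].
Qed.

Lemma Ck_onM k (f g : 'rV[R]_n -> R) :
  Ck_on k U f -> Ck_on k U g -> Ck_on k U (fun y => f y * g y).
Proof.
elim: k f g => [|k IH] f g.
  by move=> cf cg y Uy; exact: continuousM (cf _ Uy) (cg _ Uy).
move=> Cf Cg; have [df dif] := Cf; have [dg dig] := Cg.
split=> [y Uy|i]; first exact: differentiableM (df _ Uy) (dg _ Uy).
apply: Ck_on_eq (Ck_onD (IH _ _ (Ck_onW Cf) (dig i))
  (IH _ _ (Ck_onW Cg) (dif i))) => z Uz.
by rewrite /pderiv deriveM//; apply: diff_derivable; [exact: df|exact: dg].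
Qed.

Lemma Ck_onN k (f : 'rV[R]_n -> R) :
  Ck_on k U f -> Ck_on k U (fun y => - f y).
Proof.
move=> Cf; apply: Ck_on_eq (Ck_onM (Ck_on_cst k (-1 : R)) Cf) => z _.
by rewrite mulN1r.
Qed.

Lemma Ck_onB k (f g : 'rV[R]_n -> R) :
  Ck_on k U f -> Ck_on k U g -> Ck_on k U (fun y => f y - g y).
Proof. by move=> Cf Cg; exact/(Ck_onD Cf)/Ck_onN. Qed.

Lemma Ck_on_sum k (I : Type) (r : seq I) (P : pred I)
    (F : I -> 'rV[R]_n -> R) :
  (forall i, P i -> Ck_on k U (F i)) ->
  Ck_on k U (fun y => \sum_(i <- r | P i) F i y).
Proof.
move=> CF; elim: r => [|i r IH].
  by apply: Ck_on_eq (Ck_on_cst k _) => y _; rewrite big_nil.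
rewrite (_ : (fun _ => _) = fun y =>
  if P i then F i y + \sum_(j <- r | P j) F j y
  else \sum_(j <- r | P j) F j y); last first.
  by apply/funext => y; rewrite big_cons.
by case Pi: (P i) => //; apply: Ck_onD => //; exact: CF.
Qed.

Lemma Ck_on_prod k (I : Type) (r : seq I) (P : pred I)
    (F : I -> 'rV[R]_n -> R) :
  (forall i, P i -> Ck_on k U (F i)) ->
  Ck_on k U (fun y => \prod_(i <- r | P i) F i y).
Proof.
move=> CF; elim: r => [|i r IH].
  by apply: Ck_on_eq (Ck_on_cst k _) => y _; rewrite big_nil.
rewrite (_ : (fun _ => _) = fun y =>
  if P i then F i y * \prod_(j <- r | P j) F j y
  else \prod_(j <- r | P j) F j y); last first.
  by apply/funext => y; rewrite big_cons.
by case Pi: (P i) => //; apply: Ck_onM => //; exact: CF.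
Qed.

Lemma Ck_onV k (f : 'rV[R]_n -> R) : (forall y, U y -> f y != 0) ->
  Ck_on k U f -> Ck_on k U (fun y => (f y)^-1).
Proof.
move=> f0; elim: k => [|k IH].
  by move=> cf y Uy; exact: cvgV (f0 _ Uy) (cf _ Uy).
move=> Cf; have [df dif] := Cf; have CV := IH (Ck_onW Cf).
split=> [y Uy|i]; first exact: differentiableV (df _ Uy) (f0 _ Uy).
apply: Ck_on_eq (Ck_onN (Ck_onM (Ck_onM CV CV) (dif i))) => z Uz.
rewrite /pderiv deriveV ?f0//; last exact/diff_derivable/df.
by rewrite -exprVn expr2 scaleNr.
Qed.

Lemma Ck_on_entry k p q (F : 'rV[R]_n -> 'M[R]_(p, q)) i j :
  Ck_on k U F -> Ck_on k U (fun y => F y i j).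
Proof.
elim: k F => [|k IH] F.
  move=> cF y Uy.
  exact: (continuous_comp (cF _ Uy) (@coord_continuous _ _ _ i j _)).
move=> [dF diF]; split=> [y Uy|l].
  exact: (differentiable_comp (dF _ Uy) (differentiable_coord _ i j)).
apply: Ck_on_eq (IH _ (diF l)) => z Uz.
by rewrite /pderiv derive_mx ?mxE//; exact/diff_derivable/dF.
Qed.

Lemma Ck_on_det k p (F : 'rV[R]_n -> 'M[R]_p) :
  (forall i j, Ck_on k U (fun y => F y i j)) -> Ck_on k U (fun y => \det (F y)).
Proof.
move=> CF; apply: Ck_on_sum => s _; apply: Ck_onM; first exact: Ck_on_cst.
by apply: Ck_on_prod => i _; exact: CF.
Qed.

(** Cramer's rule: [invmx] is the adjugate divided by the determinant, and both
are polynomial in the entries. *)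
Lemma Ck_on_invmx k p (F : 'rV[R]_n -> 'M[R]_p) :
  (forall y, U y -> F y \in unitmx) ->
  (forall i j, Ck_on k U (fun y => F y i j)) ->
  forall i j, Ck_on k U (fun y => invmx (F y) i j).
Proof.
move=> uF CF i j.
have CV : Ck_on k U (fun y => (\det (F y))^-1).
  apply: Ck_onV; last exact: Ck_on_det.
  by move=> y /uF; rewrite unitmxE unitfE.
have Cadj : Ck_on k U (fun y => \adj (F y) i j).
  rewrite (_ : (fun y => _) =
    fun y => (-1) ^+ (j + i) * \det (row' j (col' i (F y)))); last first.
    by apply/funext => y; rewrite mxE.
  apply: Ck_onM; first exact: Ck_on_cst.
  apply: Ck_on_det => a b.
  rewrite (_ : (fun y => _) = fun y => F y (lift j a) (lift i b)) //.
  by apply/funext => y; rewrite 2!mxE.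
apply: Ck_on_eq (Ck_onM CV Cadj) => z Uz.
by rewrite /invmx uF// !mxE.
Qed.

End SmoothCalculus.

(** * Symmetry of second derivatives *)

Lemma is_derive_line (R : numFieldType) (V : normedModType R)
    (f : V -> R) (a w : V) (s : R) :
  derivable f (s *: a + w) a ->
  is_derive s 1 (fun r => f (r *: a + w)) ('D_a f (s *: a + w)).
Proof.
move=> df.
have E : (fun h : R => h^-1 *: (f ((h *: 1 + s) *: a + w) - f (s *: a + w))) =
         (fun h : R => h^-1 *: (f (h *: a + (s *: a + w)) - f (s *: a + w))).
  by apply/funext => h; rewrite scalerDl addrA [h *: 1]mulr1.
split; first by rewrite /derivable /= E.
by rewrite /derive /= E.
Qed.

(** The mean value theorem in the direction [a] turns the second difference of
[f] into [h] times an increment of ['D_a f] along [h *: b], and the total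
differential of ['D_a f] at [y] evaluates this increment up to [o(h)]. *)
Lemma second_difference (R : realType) (V : normedModType R)
    (f : V -> R) (a b y : V) (e : R) :
  (\forall z \near y, differentiable f z) -> differentiable ('D_a f) y ->
  0 < e -> \forall h \near (0 : R)^'+,
    `|f (h *: a + (h *: b + y)) - f (h *: a + y) - (f (h *: b + y) - f y)
      - h ^+ 2 * 'D_b ('D_a f) y| <= e * h ^+ 2.
Proof.
move=> df dDf e0.
(* [C * h] bounds the displacement; two values of ['D_a f] are compared, each
   with error at most [e / (2 * C) * (C * h)]. *)
pose C := `|a| + `|b| + 1.
have C0 : 0 < C by rewrite ltr_wpDl// addr_ge0.
have eC0 : 0 < e / (2 * C) by rewrite divr_gt0// mulr_gt0.
have /diff_locally/eqaddoP/(_ _ eC0) := dDf.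
move=> /nbhs_ballP[d1 /= d10 Hd1].
have /nbhs_ballP[d2 /= d20 Hd2] := df.
have small h c t : 0 < h -> h < d1 / C -> h < d2 / C -> 0 <= c -> c <= h ->
    0 <= t -> t <= h ->
    [/\ `|c *: a + t *: b| <= C * h, `|c *: a + t *: b| < d1
      & differentiable f (c *: a + (t *: b + y))].
  move=> h0 h1 h2 c0 ch t0 th.
  have H : `|c *: a + t *: b| <= C * h.
    rewrite (le_trans (ler_normD _ _))// !normrZ !ger0_norm//.
    rewrite /C !mulrDl mul1r.
    have := ler_wpM2r (normr_ge0 a) ch; have := ler_wpM2r (normr_ge0 b) th.
    by lra.
  have H1 : C * h < d1 by rewrite mulrC -ltr_pdivlMr.
  have H2 : C * h < d2 by rewrite mulrC -ltr_pdivlMr.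
  split=> //; first exact: le_lt_trans H1.
  apply: Hd2; rewrite -ball_normE /ball_ /= addrA opprD addrCA subrr.
  rewrite addr0 normrN.
  exact: le_lt_trans H2.
near=> h.
have h0 : 0 < h by near: h; exact: nbhs_right_gt.
have h1 : h < d1 / C by near: h; apply: nbhs_right_lt; rewrite divr_gt0.
have h2 : h < d2 / C by near: h; apply: nbhs_right_lt; rewrite divr_gt0.
pose phi s := f (s *: a + (h *: b + y)) - f (s *: a + y).
pose dphi s := 'D_a f (s *: a + (h *: b + y)) - 'D_a f (s *: a + y).
have dphiP s : 0 <= s -> s <= h -> is_derive s 1 phi (dphi s).
  move=> s0 sh; apply: is_deriveB.
    apply/is_derive_line/diff_derivable.
    by have [] := small h s h h0 h1 h2 s0 sh (ltW h0) (lexx _).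
  apply/is_derive_line/diff_derivable.
  have [_ _] := small h s 0 h0 h1 h2 s0 sh (lexx _) (ltW h0).
  by rewrite scale0r add0r.
have [|||c] := @MVT R phi dphi 0 h.
- exact: h0.
- by move=> s; rewrite in_itv/= => /andP[s0 sh]; apply: dphiP; exact: ltW.
- apply: derivable_within_continuous => s; rewrite in_itv/= => /andP[s0 sh].
  by have [] := dphiP s s0 sh.
rewrite in_itv/= => /andP[/ltW c0 /ltW ch].
rewrite /phi !scale0r !add0r subr0 => ->.
have Hd t : 0 <= t -> t <= h ->
   `|'D_a f (c *: a + (t *: b + y)) - 'D_a f y
     - 'd ('D_a f) y (c *: a + t *: b)| <= e / 2 * h.
  move=> t0 th; have [n1 n2 _] := small h c t h0 h1 h2 c0 ch t0 th.
  have := Hd1 (c *: a + t *: b).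
  rewrite -ball_normE /ball_ /= sub0r normrN => /(_ n2).
  rewrite !fctE /= addrA opprD addrA => H; apply: le_trans H _.
  apply: (@le_trans _ _ (e / (2 * C) * (C * h))).
    by apply: ler_wpM2l; rewrite // ltW.
  by rewrite le_eqVlt; apply/orP; left; apply/eqP; field; rewrite gt_eqF.
have Hh := Hd h (ltW h0) (lexx _).
have H0 := Hd 0 (lexx _) (ltW h0).
rewrite scale0r add0r addr0 in H0.
have EL : 'd ('D_a f) y (c *: a + h *: b) =
    'd ('D_a f) y (c *: a) + h * 'D_b ('D_a f) y.
  by rewrite deriveE// linearD [X in _ + X]linearZ.
rewrite EL in Hh.
have -> : dphi c * h - h ^+ 2 * 'D_b ('D_a f) y =
  (('D_a f (c *: a + (h *: b + y)) - 'D_a f y -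
       ('d ('D_a f) y (c *: a) + h * 'D_b ('D_a f) y))
   - ('D_a f (c *: a + y) - 'D_a f y - 'd ('D_a f) y (c *: a))) * h.
  by rewrite /dphi; ring.
rewrite normrM (ger0_norm (ltW h0)) expr2 mulrA ler_pM2r//.
rewrite (le_trans (ler_normB _ _))//.
have -> : e * h = e / 2 * h + e / 2 * h by field.
exact: lerD.
Unshelve. all: by end_near. Qed.

(** The second difference of [f] is symmetric in [a] and [b], so its quotient by
[h ^+ 2] tends to both mixed derivatives.  Total differentiability of the two
first derivatives replaces the usual continuity of the second ones. *)
Lemma derive_sym (R : realType) (V : normedModType R)
    (f : V -> R) (a b y : V) :
  (\forall z \near y, differentiable f z) ->
  differentiable ('D_a f) y -> differentiable ('D_b f) y ->
  'D_b ('D_a f) y = 'D_a ('D_b f) y.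
Proof.
move=> df da db; apply/eqP; rewrite -subr_eq0 -normr_le0.
apply/ler_addgt0Pr => e e0; rewrite add0r.
have e20 : 0 < e / 2 by rewrite divr_gt0.
have Ha := @second_difference _ _ f a b y _ df da e20.
have Hb := @second_difference _ _ f b a y _ df db e20.
move: ('D_b ('D_a f) y) ('D_a ('D_b f) y) Ha Hb => A B Ha Hb.
have : \forall h \near (0 : R)^'+, `|A - B| <= e.
  near=> h.
  have h0 : 0 < h by near: h; exact: nbhs_right_gt.
  have h20 : 0 < h ^+ 2 by rewrite exprn_gt0.
  rewrite -(ler_pM2r h20) -[in X in X <= _](ger0_norm (ltW h20)) -normrM.
  have HA : `|f (h *: a + (h *: b + y)) - f (h *: a + y)
      - (f (h *: b + y) - f y) - h ^+ 2 * A| <= e / 2 * h ^+ 2.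
    by near: h; exact: Ha.
  have HB : `|f (h *: b + (h *: a + y)) - f (h *: b + y)
      - (f (h *: a + y) - f y) - h ^+ 2 * B| <= e / 2 * h ^+ 2.
    by near: h; exact: Hb.
  rewrite [h *: b + (_ + _)]addrCA in HB.
  rewrite distrC in HA.
  have -> : (A - B) * h ^+ 2 =
    (h ^+ 2 * A - (f (h *: a + (h *: b + y)) - f (h *: a + y)
                   - (f (h *: b + y) - f y)))
   + (f (h *: a + (h *: b + y)) - f (h *: b + y) - (f (h *: a + y) - f y)
      - h ^+ 2 * B) by ring.
  rewrite (le_trans (ler_normD _ _))//.
  have -> : e * h ^+ 2 = e / 2 * h ^+ 2 + e / 2 * h ^+ 2 by field.
  exact: lerD.
move=> H; have [h] := @filter_ex _ _ (at_right_proper_filter (0 : R)) _ H.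
by [].
Unshelve. all: by end_near. Qed.

(** * Partial derivatives *)

Section PartialDerivatives.
Context {R : realType} {n : nat}.
Implicit Types (f h : 'rV[R]_n -> R) (y : 'rV[R]_n).

Lemma pderivD i f h y : differentiable f y -> differentiable h y ->
  pderiv i (fun z => f z + h z) y = pderiv i f y + pderiv i h y.
Proof. by move=> df dh; rewrite /pderiv deriveD//; exact: diff_derivable. Qed.

Lemma pderivM i f h y : differentiable f y -> differentiable h y ->
  pderiv i (fun z => f z * h z) y = pderiv i f y * h y + f y * pderiv i h y.
Proof.
move=> df dh; rewrite /pderiv deriveM; [|exact: diff_derivable..].
by rewrite addrC [_ *: _ in X in X + _]mulrC.
Qed.

Lemma pderivZ i (a : R) f y : differentiable f y ->
  pderiv i (fun z => a * f z) y = a * pderiv i f y.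
Proof.
by move=> df; rewrite pderivM// /pderiv derive_cst mul0r add0r.
Qed.

Lemma pderiv_sum i (m : nat) (F : 'I_m -> 'rV[R]_n -> R) y :
  (forall l, differentiable (F l) y) ->
  pderiv i (fun z => \sum_l F l z) y = \sum_l pderiv i (F l) y.
Proof.
move=> dF; rewrite /pderiv -derive_sum; last by move=> l; exact: diff_derivable.
by rewrite fct_sumE.
Qed.

Lemma differentiable_fsum (m : nat) (F : 'I_m -> 'rV[R]_n -> R) y :
  (forall l, differentiable (F l) y) ->
  differentiable (fun z => \sum_l F l z) y.
Proof. by move=> dF; rewrite -fct_sumE; exact: differentiable_sum. Qed.

Lemma differentiable_entry p q (F : 'rV[R]_n -> 'M[R]_(p, q)) i j y :
  differentiable F y -> differentiable (fun z => F z i j) y.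
Proof.
by move=> dF; exact: (differentiable_comp dF (differentiable_coord _ i j)).
Qed.

Lemma jacobian_entry (t : 'rV[R]_n -> 'rV[R]_n) y i l : differentiable t y ->
  'J t y i l = pderiv i (fun z => t z 0 l) y.
Proof.
move=> dt; rewrite /jacobian mxE -deriveE// derive_mx ?mxE//.
exact: diff_derivable.
Qed.

Lemma pderiv_comp (t : 'rV[R]_n -> 'rV[R]_n) h y i :
  differentiable t y -> differentiable h (t y) ->
  pderiv i (fun z => h (t z)) y = \sum_l 'J t y i l * pderiv l h (t y).
Proof.
move=> dt dh; rewrite /pderiv deriveE; last exact: differentiable_comp.
rewrite [X in X _ = _](_ : _ = 'd h (t y) \o 'd t y); last exact: diff_comp.
have Et : 'd t y (delta_mx 0 i) = row i ('J t y).
  by rewrite -deriveE// deriveEjacobian// -rowE.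
rewrite /= Et [in LHS](row_sum_delta (row i ('J t y))) linear_sum.
by apply: eq_bigr => l _; rewrite linearZ mxE deriveE.
Qed.

End PartialDerivatives.

(** * Behaviour of the Laplacian under a change of coordinates *)

Section ChangeOfCoordinates.
Context {R : realType} {n : nat}.

(** Twice the Christoffel symbol of the first kind, [l] being the lowered
index. *)
Definition first_kind (G : 'rV[R]_n -> 'M[R]_n) (l i j : 'I_n) y : R :=
  pderiv i (fun z => G z j l) y + pderiv j (fun z => G z i l) y
     - pderiv l (fun z => G z i j) y.

Lemma mulmx_invmx_congr (P G : 'M[R]_n) :
  P \in unitmx -> G \in unitmx ->
  P^T *m invmx (P *m G *m P^T) *m P = invmx G.
Proof.
move=> uP uG.
have uPT : P^T \in unitmx by rewrite unitmx_tr.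
have uH : P *m G *m P^T \in unitmx by rewrite !unitmx_mul uP uG.
apply: (can_inj (mulKmx uG)); rewrite mulmxV//.
apply: (can_inj (mulKmx uP)); rewrite mulmx1 !mulmxA mulmxV//.
by rewrite mul1mx.
Qed.

Lemma local_laplacian_trace (G : 'rV[R]_n -> 'M[R]_n) u y :
  local_laplacian G u y =
  - \tr (invmx (G y) *m (\matrix_(i, j) hessian G u i j y)^T).
Proof.
congr (- _); apply: eq_bigr => i _; rewrite mxE; apply: eq_bigr => j _.
by rewrite !mxE.
Qed.

Lemma christoffel_row (G : 'rV[R]_n -> 'M[R]_n) i j y : (G y)^T = G y ->
  \row_k christoffel G k i j y =
  2^-1 *: ((\row_l first_kind G l i j y) *m invmx (G y)).
Proof.
move=> sG; apply/rowP => k; rewrite !mxE; congr (_ * _).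
apply: eq_bigr => l _; rewrite !mxE mulrC; congr (_ * _).
by rewrite /ginv -[in LHS]sG -trmx_inv mxE.
Qed.

(** [t] is a change of coordinates on [A], and [Ga], [Gb] are the matrices of
one metric before and after it.  Invertibility of the Jacobian is a consequence
of the invertibility of [Ga]. *)
Variables (A : set 'rV[R]_n) (t : 'rV[R]_n -> 'rV[R]_n).
Variables (Ga Gb : 'rV[R]_n -> 'M[R]_n).
Hypothesis openA : open A.
Hypothesis C2t : Ck_on 2 A t.
Hypothesis dGb : forall y, A y -> differentiable Gb (t y).
Hypothesis symb : forall y, A y -> (Gb (t y))^T = Gb (t y).
Hypothesis unita : forall y, A y -> Ga y \in unitmx.
Hypothesis unitb : forall y, A y -> Gb (t y) \in unitmx.
Hypothesis change : forall y, A y ->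
  Ga y = 'J t y *m Gb (t y) *m ('J t y)^T.

Let dt y : A y -> differentiable t y.
Proof. by case: C2t => H _; exact: H. Qed.

Let J i l y := pderiv i (fun z => t z 0 l) y.

Let J_E y i l : A y -> 'J t y i l = J i l y.
Proof. by move=> Ay; exact/jacobian_entry/dt. Qed.

Let dJ y i l : A y -> differentiable (J i l) y.
Proof.
have [_ H] := Ck_on_entry openA 0 l C2t.
by have [H' _] := H i; exact: H'.
Qed.

Let H i j p y := pderiv i (J j p) y.

Let H_sym y i j p : A y -> H i j p y = H j i p y.
Proof.
move=> Ay; have [Hd _] := Ck_on_entry openA 0 p C2t.
apply: derive_sym; [|exact: dJ..].
by near=> z; apply: Hd; near: z; exact: open_nbhs_nbhs.
Unshelve. all: by end_near. Qed.

Let dGbt y p q : A y -> differentiable (fun z => Gb (t z) p q) y.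
Proof.
move=> Ay; apply: (differentiable_entry p q).
exact: differentiable_comp (dt Ay) (dGb Ay).
Qed.

Let Ga_sym y : A y -> (Ga y)^T = Ga y.
Proof. by move=> Ay; rewrite change// !trmx_mul trmxK symb// mulmxA. Qed.

Let unitJ y : A y -> 'J t y \in unitmx.
Proof.
by move=> Ay; have := unita Ay; rewrite change// !unitmx_mul => /andP[/andP[]].
Qed.

Let Ga_entry y j l : A y ->
  Ga y j l = \sum_p \sum_q J j p y * Gb (t y) p q * J l q y.
Proof.
move=> Ay; rewrite change// mxE exchange_big /=; apply: eq_bigr => q _.
rewrite [(_ *m _) _ _]mxE [_^T _ _]mxE J_E// mulr_suml; apply: eq_bigr => p _.
by rewrite J_E.
Qed.

Let pderiv_Ga y i j l : A y ->
  pderiv i (fun z => Ga z j l) y =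
  \sum_p \sum_q (H i j p y * Gb (t y) p q * J l q y
    + J j p y * (\sum_r J i r y * pderiv r (fun z => Gb z p q) (t y)) * J l q y
    + J j p y * Gb (t y) p q * H i l q y).
Proof.
move=> Ay.
rewrite (pderiv_eq openA _ (fun z Az => Ga_entry j l Az))//.
have dm p q : differentiable (fun z => J j p z * Gb (t z) p q) y.
  by apply: differentiableM; [exact: dJ|exact: dGbt].
have dmm p q : differentiable (fun z => J j p z * Gb (t z) p q * J l q z) y.
  by apply: differentiableM; [exact: dm|exact: dJ].
rewrite pderiv_sum; last by move=> p; exact: differentiable_fsum.
apply: eq_bigr => p _; rewrite pderiv_sum//; apply: eq_bigr => q _.
rewrite pderivM//; last exact: dJ.
rewrite pderivM//; [|exact: dJ|exact: dGbt].
rewrite (pderiv_comp (h := fun z => Gb z p q))//; first last.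
- exact/differentiable_entry/dGb.
- exact: dt.
rewrite mulrDl; congr (_ + _ * _ * _ + _).
by apply: eq_bigr => r _; rewrite J_E.
Qed.

(** Differentiating [Ga = J Gb J^T] produces terms [a] with one second
derivative of [t] and terms [b] with a derivative of [Gb].  In the alternating
sum of three derivatives that defines [first_kind], symmetry of the second
derivatives cancels all the [a] but two equal ones. *)
Lemma first_kind_change y i j l : A y ->
  first_kind Ga l i j y =
  \sum_r (2 * (\sum_p H i j p y * Gb (t y) p r)
          + \sum_p \sum_q J i p y * J j q y * first_kind Gb r p q (t y))
         * J l r y.
Proof.
move=> Ay.
pose a i j l := \sum_p \sum_r H i j p y * Gb (t y) p r * J l r y.
pose b i j l := \sum_r \sum_p \sum_q
  J i p y * J j q y * J l r y * pderiv p (fun z => Gb z q r) (t y).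
have Gs p q : Gb (t y) p q = Gb (t y) q p by rewrite -[in LHS]symb// mxE.
have dG i' j' l' : pderiv i' (fun z => Ga z j' l') y =
    a i' j' l' + b i' j' l' + a i' l' j'.
  rewrite pderiv_Ga//; under eq_bigr do rewrite !big_split /=.
  rewrite !big_split /=; congr (_ + _ + _).
    rewrite /b exchange_big /=; apply: eq_bigr => r _.
    rewrite exchange_big /=; apply: eq_bigr => p _.
    rewrite mulr_sumr mulr_suml; apply: eq_bigr => q _.
    by ring.
  rewrite /a exchange_big /=; apply: eq_bigr => q _; apply: eq_bigr => p _.
  by rewrite Gs; ring.
have as_ i' j' l' : a i' j' l' = a j' i' l'.
  by apply: eq_bigr => p _; apply: eq_bigr => r _; rewrite H_sym.
rewrite {1}/first_kind !dG (as_ j i l) (as_ i l j) (as_ j l i).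
have -> : forall x1 x2 x3 b1 b2 b3 : R,
  x1 + b1 + x2 + (x1 + b2 + x3) - (x2 + b3 + x3) = 2 * x1 + (b1 + b2 - b3).
  by move=> *; ring.
under [RHS]eq_bigr do rewrite mulrDl; rewrite big_split /=; congr (_ + _).
  rewrite /a exchange_big mulr_sumr /=; apply: eq_bigr => r _.
  by rewrite -mulrA mulr_suml.
(* Renaming the summation indices gives the three [b] the common factor
   [J i p y * J j q y * J l r y]. *)
have -> : b j i l = \sum_r \sum_p \sum_q
  J i p y * J j q y * J l r y * pderiv q (fun z => Gb z p r) (t y).
  apply: eq_bigr => r _; rewrite exchange_big; apply: eq_bigr => p _.
  by apply: eq_bigr => q _; ring.
have -> : b l i j = \sum_r \sum_p \sum_q
  J i p y * J j q y * J l r y * pderiv r (fun z => Gb z p q) (t y).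
  rewrite /b exchange_big; apply: eq_bigr => r _; rewrite exchange_big.
  by apply: eq_bigr => p _; apply: eq_bigr => q _; ring.
rewrite /b -big_split -sumrB /=; apply: eq_bigr => r _.
rewrite -big_split -sumrB mulr_suml /=; apply: eq_bigr => p _.
rewrite -big_split -sumrB mulr_suml /=; apply: eq_bigr => q _.
by rewrite /first_kind; ring.
Qed.

(** The transformation law of the Levi-Civita connection, contracted with the
Jacobian so that no inverse of [J] occurs. *)
Lemma christoffel_change y i j s : A y ->
  \sum_k christoffel Ga k i j y * J k s y =
  H i j s y + \sum_p \sum_q J i p y * J j q y * christoffel Gb s p q (t y).
Proof.
move=> Ay.
pose hr := \row_p H i j p y : 'rV[R]_n.
pose fb p q := \row_l first_kind Gb l p q (t y) : 'rV[R]_n.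
pose w := \sum_p \sum_q (J i p y * J j q y) *: fb p q.
have Ea : \row_l first_kind Ga l i j y =
    (2 *: (hr *m Gb (t y)) + w) *m ('J t y)^T.
  apply/rowP => l; rewrite [LHS]mxE first_kind_change// [RHS]mxE.
  apply: eq_bigr => r _; rewrite [in RHS](mxE _ _ r l) J_E//; congr (_ * _).
  rewrite !mxE; congr (2 * _ + _).
    by apply: eq_bigr => p _; rewrite mxE.
  rewrite summxE; apply: eq_bigr => p _; rewrite summxE; apply: eq_bigr => q _.
  by rewrite !mxE.
have key : (\row_k christoffel Ga k i j y) *m 'J t y =
  hr + \sum_p \sum_q
    (J i p y * J j q y) *: (\row_k christoffel Gb k p q (t y)).
  rewrite christoffel_row ?Ga_sym// Ea change// -scalemxAl.
  rewrite -(mulmxA _ ('J t y)^T) -(mulmxA _ (('J t y)^T *m _)).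
  rewrite mulmx_invmx_congr ?unitJ ?unitb//.
  rewrite mulmxDl scalerDr -scalemxAl scalerA mulVf ?pnatr_eq0// scale1r.
  rewrite mulmxK ?unitb//; congr (_ + _).
  rewrite mulmx_suml scaler_sumr; apply: eq_bigr => p _.
  rewrite mulmx_suml scaler_sumr; apply: eq_bigr => q _.
  by rewrite christoffel_row ?symb// -scalemxAl !scalerA mulrC.
have := congr1 (fun M : 'rV[R]_n => M 0 s) key.
rewrite [LHS]mxE.
under [in LHS]eq_bigr do rewrite mxE J_E//.
move=> ->; rewrite !mxE; congr (_ + _).
rewrite summxE; apply: eq_bigr => p _; rewrite summxE; apply: eq_bigr => q _.
by rewrite !mxE.
Qed.

Variables (u v : 'rV[R]_n -> R).
Hypothesis uv : forall y, A y -> u y = v (t y).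
Hypothesis dv : forall y, A y -> differentiable v (t y).
Hypothesis ddv : forall l y, A y -> differentiable (pderiv l v) (t y).

Let grad_change y i : A y ->
  pderiv i u y = \sum_l J i l y * pderiv l v (t y).
Proof.
move=> Ay; rewrite (pderiv_eq openA _ uv)// pderiv_comp; [|exact: dt|exact: dv].
by apply: eq_bigr => l _; rewrite J_E.
Qed.

(** The second derivatives of [t] coming from the chain rule for [v \o t] cancel
those in the transformation law of the Christoffel symbols. *)
Lemma hessian_change y i j : A y ->
  hessian Ga u i j y =
  \sum_k \sum_l J i k y * J j l y * hessian Gb v k l (t y).
Proof.
move=> Ay; rewrite /hessian.
have dvt l : differentiable (fun z => pderiv l v (t z)) y.
  exact: (differentiable_comp (dt Ay) (ddv l Ay)).
rewrite (pderiv_eq openA _ (fun z Az => grad_change j Az))//.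
rewrite pderiv_sum; last first.
  by move=> l; apply: differentiableM; [exact: dJ|exact: dvt].
have -> : \sum_l pderiv i (fun z => J j l z * pderiv l v (t z)) y =
  \sum_l H i j l y * pderiv l v (t y) +
  \sum_k \sum_l J i k y * J j l y * pderiv k (pderiv l v) (t y).
  rewrite [X in _ = _ + X]exchange_big -big_split; apply: eq_bigr => l _ /=.
  rewrite pderivM; [|exact: dJ|exact: dvt]; congr (_ + _).
  rewrite pderiv_comp; [|exact: dt|exact: ddv].
  rewrite mulr_sumr; apply: eq_bigr => k _; rewrite J_E//.
  by rewrite mulrCA mulrA.
have -> : \sum_k christoffel Ga k i j y * pderiv k u y =
  \sum_s (\sum_k christoffel Ga k i j y * J k s y) * pderiv s v (t y).
  under [RHS]eq_bigr do rewrite mulr_suml.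
  rewrite exchange_big; apply: eq_bigr => k _; rewrite grad_change//= mulr_sumr.
  by apply: eq_bigr => s _; rewrite mulrA.
under [X in _ - X]eq_bigr do rewrite christoffel_change// mulrDl.
rewrite big_split /= opprD addrACA subrr add0r.
under [RHS]eq_bigr do under eq_bigr do rewrite mulrBr.
under [RHS]eq_bigr do rewrite sumrB.
rewrite sumrB; congr (_ - _).
under eq_bigr do rewrite mulr_suml.
rewrite exchange_big; apply: eq_bigr => p _ /=.
under eq_bigr do rewrite mulr_suml.
rewrite exchange_big; apply: eq_bigr => q _ /=.
by rewrite mulr_sumr; apply: eq_bigr => s _; rewrite -[LHS]mulrA.
Qed.

Lemma local_laplacian_change y : A y ->
  local_laplacian Ga u y = local_laplacian Gb v (t y).
Proof.
move=> Ay; rewrite !local_laplacian_trace; congr (- _).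
have -> : \matrix_(i, j) hessian Ga u i j y =
  'J t y *m (\matrix_(k, l) hessian Gb v k l (t y)) *m ('J t y)^T.
  apply/matrixP => i j.
  rewrite [LHS]mxE hessian_change// [RHS]mxE exchange_big /=.
  apply: eq_bigr => l _; rewrite [(_ *m _) _ _]mxE [_^T _ _]mxE mulr_suml.
  apply: eq_bigr => k _; rewrite !J_E// [(\matrix_(_, _) _) _ _]mxE.
  by rewrite mulrAC.
rewrite !trmx_mul trmxK !mulmxA mxtrace_mulC !mulmxA change//.
by rewrite mulmx_invmx_congr ?unitJ ?unitb.
Qed.

End ChangeOfCoordinates.

(** * The Laplacian on smooth functions of a manifold *)

Section LocalSmoothness.
Context {R : realType} {n : nat} (U : set 'rV[R]_n) (openU : open U).

Lemma smooth_on_pderiv (V : normedModType R) (f : 'rV[R]_n -> V) i :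
  smooth_on U f -> smooth_on U (pderiv i f).
Proof. by move=> Sf k; have [_ H] := Sf k.+1; exact: H. Qed.

Lemma smooth_on_differentiable (V : normedModType R) (f : 'rV[R]_n -> V) y :
  smooth_on U f -> U y -> differentiable f y.
Proof. by move=> Sf Uy; have [H _] := Sf 1; exact: H. Qed.

Lemma smooth_on_local_laplacian (G : 'rV[R]_n -> 'M[R]_n) (u : 'rV[R]_n -> R) :
  smooth_on U G -> (forall y, U y -> G y \in unitmx) -> smooth_on U u ->
  smooth_on U (local_laplacian G u).
Proof.
move=> SG uG Su k.
have SGe i j : smooth_on U (fun y => G y i j) by move=> l; exact: Ck_on_entry.
have CV i j : Ck_on k U (ginv G i j).
  by apply: (Ck_on_invmx openU uG) => a b; exact: SGe.
have CdG l i j : Ck_on k U (pderiv l (fun y => G y i j)).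
  exact/smooth_on_pderiv/SGe.
have Cdu i : Ck_on k U (pderiv i u) by exact/smooth_on_pderiv.
have Cddu i j : Ck_on k U (pderiv i (pderiv j u)).
  exact/smooth_on_pderiv/smooth_on_pderiv.
apply: Ck_onN => //; apply: Ck_on_sum => // i _; apply: Ck_on_sum => // j _.
apply: Ck_onM => //; apply: Ck_onB => //.
apply: Ck_on_sum => // m _; apply: Ck_onM => //.
apply: Ck_onM => //; first exact: Ck_on_cst.
apply: Ck_on_sum => // l _; apply: Ck_onM => //.
by apply: Ck_onB => //; exact: Ck_onD.
Qed.

Lemma local_laplacian_linear (G : 'rV[R]_n -> 'M[R]_n) (a : R)
    (u v : 'rV[R]_n -> R) y :
  smooth_on U u -> smooth_on U v -> U y ->
  local_laplacian G (fun z => a * u z + v z) y =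
  a * local_laplacian G u y + local_laplacian G v y.
Proof.
move=> Su Sv Uy.
have lin (f h : 'rV[R]_n -> R) i z : smooth_on U f -> smooth_on U h -> U z ->
    pderiv i (fun z => a * f z + h z) z = a * pderiv i f z + pderiv i h z.
  move=> Sf Sh Uz.
  have df := smooth_on_differentiable Sf Uz.
  have dh := smooth_on_differentiable Sh Uz.
  rewrite pderivD//; last exact: differentiableZ.
  by rewrite pderivZ.
have hlin i j : hessian G (fun z => a * u z + v z) i j y =
    a * hessian G u i j y + hessian G v i j y.
  rewrite /hessian (pderiv_eq openU _ (fun z Uz => lin _ _ j z Su Sv Uz))//.
  rewrite lin//; [|exact: smooth_on_pderiv..].
  under eq_bigr do rewrite lin// mulrDr mulrCA.
  by rewrite big_split -mulr_sumr /=; ring.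
rewrite /local_laplacian.
under eq_bigr do under eq_bigr do rewrite hlin mulrDr mulrCA.
under eq_bigr do rewrite big_split -mulr_sumr /=.
by rewrite big_split -mulr_sumr /=; ring.
Qed.

End LocalSmoothness.

(* The coordinate map of a chart, not the coordinates of a vector. *)
Local Notation coord := Defs.coord.

Section Global.
Context {R : realType} {n : nat} (M : manifold R n)
        (g : pseudo_riemannian_metric M).

Lemma open_overlap (a b : atlas_index M) :
  open (coord (atlas a) @` (dom (atlas a) `&` dom (atlas b))).
Proof.
rewrite openE => _ [x [ax bx] <-].
have ix : (coord (atlas a) @` dom (atlas a)) (coord (atlas a) x) by exists x.
have ca : param (atlas a) @ coord (atlas a) x -->
    param (atlas a) (coord (atlas a) x).
  exact: param_continuous ix.
rewrite (paramK ax) in ca.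
have Nb : \forall z \near coord (atlas a) x, dom (atlas b) (param (atlas a) z).
  by apply: ca; apply: open_nbhs_nbhs; split => //; exact: open_dom.
have Na : \forall z \near coord (atlas a) x,
    (coord (atlas a) @` dom (atlas a)) z.
  by apply: open_nbhs_nbhs; split => //; exact: open_img.
rewrite /interior; near=> z.
have [x' ax' xz] : (coord (atlas a) @` dom (atlas a)) z by near: z.
exists x' => //; split=> //.
have : dom (atlas b) (param (atlas a) z) by near: z.
by rewrite -xz paramK.
Unshelve. all: by end_near. Qed.

(** Near [x] a single chart [a] computes the Laplacian, whatever charts
[chart_at] selects there. *)
Lemma laplacianR_chart (u : M -> R) (a : atlas_index M) (x : M) :
  smoothR u -> dom (atlas a) x ->
  laplacianR g u x =
  local_laplacian (metric_mx g a) (u \o param (atlas a)) (coord (atlas a) x).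
Proof.
move=> Su ax; rewrite /laplacianR; set b := chart_at x.
have bx : dom (atlas b) x by rewrite /b /chart_at; case: cid.
pose A := coord (atlas a) @` (dom (atlas a) `&` dom (atlas b)).
pose t := transition (atlas a) (atlas b).
have Ax : A (coord (atlas a) x) by exists x.
have timg y : A y -> (coord (atlas b) @` dom (atlas b)) (t y).
  by case=> z [az bz] <-; exists z => //; rewrite /t /transition paramK.
have aimg y : A y -> (coord (atlas a) @` dom (atlas a)) y.
  by case=> z [az bz] <-; exists z.
have Et : t (coord (atlas a) x) = coord (atlas b) x.
  by rewrite /t /transition paramK.
rewrite -Et; symmetry; apply: (@local_laplacian_change _ _ A t) => //.
- exact: open_overlap.
- exact: (atlas_smooth a b 2).
- by move=> y /timg; exact/smooth_on_differentiable/metric_smooth.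
- by move=> y /timg; exact: Defs.metric_sym.
- by move=> y /aimg; exact: metric_nondegenerate.
- by move=> y /timg; exact: metric_nondegenerate.
- by move=> y Ay; exact: metric_change.
- by move=> _ [z [az bz] <-]; rewrite /t /transition /= !paramK.
- by move=> y /timg; exact/smooth_on_differentiable/Su.
- by move=> l y /timg; exact/smooth_on_differentiable/smooth_on_pderiv/Su.
Qed.

Lemma smoothR_laplacianR (u : M -> R) : smoothR u -> smoothR (laplacianR g u).
Proof.
move=> Su a k.
have oa : open (coord (atlas a) @` dom (atlas a)) by exact: open_img.
apply: (Ck_on_eq oa); last first.
  apply: (@smooth_on_local_laplacian _ _ _ oa (metric_mx g a)
    (u \o param (atlas a))).
  - exact: metric_smooth.
  - exact: metric_nondegenerate.
  - exact: Su.
by move=> _ [x ax <-]; rewrite /= paramK// (laplacianR_chart Su ax).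
Qed.

Lemma smoothR_cst (c : R) : smoothR (fun _ : M => c).
Proof. by move=> a k; apply: Ck_on_cst; exact: open_img. Qed.

Lemma smoothRD (u v : M -> R) :
  smoothR u -> smoothR v -> smoothR (fun x => u x + v x).
Proof.
by move=> Su Sv a k; apply: Ck_onD (Su a k) (Sv a k); exact: open_img.
Qed.

Lemma smoothRM (u v : M -> R) :
  smoothR u -> smoothR v -> smoothR (fun x => u x * v x).
Proof.
by move=> Su Sv a k; apply: Ck_onM (Su a k) (Sv a k); exact: open_img.
Qed.

Lemma smoothRZ (a : R) (u : M -> R) : smoothR u -> smoothR (fun x => a * u x).
Proof. exact: smoothRM (smoothR_cst a). Qed.

Lemma laplacianR_linear (a : R) (u v : M -> R) x : smoothR u -> smoothR v ->
  laplacianR g (fun z => a * u z + v z) x =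
  a * laplacianR g u x + laplacianR g v x.
Proof.
move=> Su Sv.
have [b bx] := atlas_cover x.
rewrite !(laplacianR_chart _ bx)//; last exact: (smoothRD (smoothRZ a Su) Sv).
have ix : (coord (atlas b) @` dom (atlas b)) (coord (atlas b) x) by exists x.
exact: (local_laplacian_linear (@open_img _ _ _ (atlas b)) _ a
  (Su b) (Sv b) ix).
Qed.

(** Tracing [Ric = c g] with the inverse metric gives [Sc = c n]. *)
Lemma einstein_scal_const : einstein g -> forall x y : M, scal g x = scal g y.
Proof.
case=> c Hc; suff H x : scal g x = c * n%:R by move=> x y; rewrite !H.
rewrite /scal; set b := chart_at x.
have bx : dom (atlas b) x by rewrite /b /chart_at; case: cid.
have ix : (coord (atlas b) @` dom (atlas b)) (coord (atlas b) x) by exists x.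
rewrite /local_scal Hc//; set G := metric_mx _ _.
have sG := Defs.metric_sym g ix; have uG := metric_nondegenerate g ix.
have <- : \tr (invmx (G (coord (atlas b) x)) *m G (coord (atlas b) x)) = n%:R.
  by rewrite mulVmx// mxtrace1.
rewrite mulr_sumr; apply: eq_bigr => i _; rewrite mxE mulr_sumr.
apply: eq_bigr => j _; rewrite mxE mulrCA; congr (_ * (_ * _)).
by have := congr1 (fun N : 'M[R]_n => N j i) sG; rewrite mxE.
Qed.

Lemma smooth_lin (a : R[i]) (f h : M -> R[i]) :
  smooth f -> smooth h -> smooth (fun x => a * f x + h x).
Proof.
move=> [rf jf] [rh jh]; split.
  have H := smoothRD (smoothRD (smoothRZ (complex.Re a) rf)
    (smoothRZ (- complex.Im a) jf)) rh.
  rewrite /re_part (_ : (fun x => _) = fun x => complex.Re a * re_part f x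
    + - complex.Im a * im_part f x + re_part h x)//.
  apply/funext => x; clear H; rewrite /re_part /im_part mulNr.
  by case: a (f x) (h x) => [a1 a2] [f1 f2] [h1 h2].
have H := smoothRD (smoothRD (smoothRZ (complex.Re a) jf)
  (smoothRZ (complex.Im a) rf)) jh.
rewrite /im_part (_ : (fun x => _) = fun x => complex.Re a * im_part f x
  + complex.Im a * re_part f x + im_part h x)//.
apply/funext => x; clear H; rewrite /re_part /im_part.
by case: a (f x) (h x) => [a1 a2] [f1 f2] [h1 h2].
Qed.

Lemma laplacian_linear (a : R[i]) (f h : M -> R[i]) x :
  smooth f -> smooth h ->
  laplacian g (fun x => a * f x + h x) x =
  a * laplacian g f x + laplacian g h x.
Proof.
move=> [rf jf] [rh jh]; rewrite /laplacian.
have -> : re_part (fun x => a * f x + h x) =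
    fun x => complex.Re a * re_part f x
      + (- complex.Im a * im_part f x + re_part h x).
  apply/funext => z; rewrite /re_part /im_part mulNr addrA.
  by case: a (f z) (h z) => [a1 a2] [f1 f2] [h1 h2].
have -> : im_part (fun x => a * f x + h x) =
    fun x => complex.Re a * im_part f x
      + (complex.Im a * re_part f x + im_part h x).
  apply/funext => z; rewrite /re_part /im_part addrA.
  by case: a (f z) (h z) => [a1 a2] [f1 f2] [h1 h2].
rewrite !laplacianR_linear//; [|exact: smoothRD (smoothRZ _ _) _..].
case: a => [a1 a2]; apply/eqP; rewrite eq_complex /=; apply/andP.
by split; apply/eqP; ring.
Qed.

Lemma smooth_laplacian (f : M -> R[i]) : smooth f -> smooth (laplacian g f).
Proof. by case=> rf jf; split; exact: smoothR_laplacianR. Qed.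

End Global.

(** * Polynomials in a partially linear operator *)

(** [T] is only assumed linear on a stable subspace [S], as a differential
operator is only additive on differentiable functions. *)
Section PolynomialAction.
Context {K : fieldType} {V : lmodType K} (S : V -> Prop) (T : V -> V).
Hypothesis S0 : S 0.
Hypothesis S_lin : forall a u v, S u -> S v -> S (a *: u + v).
Hypothesis S_T : forall v, S v -> S (T v).
Hypothesis T_lin : forall a u v, S u -> S v -> T (a *: u + v) = a *: T u + T v.

(** The value [p(T) v].  As [T] is linear on [S] only, it is not an element of an
algebra in which [p] could be evaluated. *)
Definition poly_act (p : {poly K}) (v : V) : V :=
  \sum_(j < size p) p`_j *: iter j T v.

Lemma poly_actE n (p : {poly K}) v : (size p <= n)%N ->
  poly_act p v = \sum_(j < n) p`_j *: iter j T v.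
Proof.
move=> pn; rewrite /poly_act (big_ord_widen n (fun j => p`_j *: iter j T v))//.
rewrite big_mkcond /=; apply: eq_bigr => j _; case: ltnP => // pj.
by rewrite nth_default// scale0r.
Qed.

Lemma poly_act0 v : poly_act 0 v = 0.
Proof. by rewrite /poly_act size_poly0 big_ord0. Qed.

Lemma poly_actD p q v : poly_act (p + q) v = poly_act p v + poly_act q v.
Proof.
pose n := maxn (size p) (size q).
rewrite (@poly_actE n) ?size_polyD// (@poly_actE n p) ?leq_maxl//.
rewrite (@poly_actE n q) ?leq_maxr//.
by rewrite -big_split; apply: eq_bigr => j _; rewrite /= coefD scalerDl.
Qed.

Lemma poly_actC a v : poly_act a%:P v = a *: v.
Proof. by rewrite (@poly_actE 1) ?size_polyC_leq1// big_ord1 coefC. Qed.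

Lemma poly_actCM a p v : poly_act (a%:P * p) v = a *: poly_act p v.
Proof.
rewrite (@poly_actE (size p)); last by rewrite mul_polyC size_scale_leq.
by rewrite scaler_sumr; apply: eq_bigr => j _; rewrite coefCM scalerA.
Qed.

Lemma poly_actMX p v : poly_act (p * 'X) v = poly_act p (T v).
Proof.
rewrite (@poly_actE (size p).+1); last first.
  by rewrite (leq_trans (size_polyMleq _ _))// size_polyX addn2.
rewrite big_ord_recl coefMX /= scale0r add0r; apply: eq_bigr => j _.
by rewrite coefMX /= -iterS iterSr.
Qed.

Lemma S_iter v : S v -> forall n, S (iter n T v).
Proof. by move=> Sv; elim=> //= n; exact: S_T. Qed.

Lemma S_sum (I : eqType) (r : seq I) (F : I -> V) :
  (forall i, i \in r -> S (F i)) -> S (\sum_(i <- r) F i).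
Proof.
elim: r => [|i r IH] SF; first by rewrite big_nil.
rewrite big_cons -[F i]scale1r; apply: S_lin.
  by apply: SF; rewrite mem_head.
by apply: IH => j jr; apply: SF; rewrite in_cons jr orbT.
Qed.

Lemma S_Z a v : S v -> S (a *: v).
Proof. by move=> Sv; rewrite -[_ *: _]addr0; exact: S_lin. Qed.

Lemma S_pact p v : S v -> S (poly_act p v).
Proof. by move=> Sv; apply: S_sum => j _; exact/S_Z/S_iter. Qed.

Lemma T0 : T 0 = 0.
Proof.
have := T_lin 1 S0 S0; rewrite !scale1r addr0 => /eqP.
by rewrite -subr_eq0 opprD addNKr oppr_eq0 => /eqP.
Qed.

Lemma poly_act_lin p a u v : S u -> S v ->
  poly_act p (a *: u + v) = a *: poly_act p u + poly_act p v.
Proof.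
move=> Su Sv.
have it n : iter n T (a *: u + v) = a *: iter n T u + iter n T v.
  by elim: n => //= n ->; rewrite T_lin//; exact: S_iter.
rewrite /poly_act scaler_sumr -big_split; apply: eq_bigr => j _ /=.
by rewrite it scalerDr !scalerA mulrC.
Qed.

Lemma poly_act_at0 p : poly_act p 0 = 0.
Proof.
apply: big1 => j _; rewrite (_ : iter j T 0 = 0) ?scaler0//.
by elim: (val j) => //= n ->; exact: T0.
Qed.

Lemma poly_act_sum p (I : eqType) (r : seq I) (F : I -> V) :
  (forall i, i \in r -> S (F i)) ->
  poly_act p (\sum_(i <- r) F i) = \sum_(i <- r) poly_act p (F i).
Proof.
elim: r => [|i r IH] SF; first by rewrite !big_nil poly_act_at0.
have SFr j : j \in r -> S (F j).
  by move=> jr; apply: SF; rewrite in_cons jr orbT.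
rewrite !big_cons -[F i]scale1r poly_act_lin ?scale1r ?IH//; last exact: S_sum.
by apply: SF; rewrite mem_head.
Qed.

Lemma poly_act_T p v : S v -> T (poly_act p v) = poly_act p (T v).
Proof.
elim/poly_ind: p v => [|p c IH] v Sv; first by rewrite !poly_act0 T0.
rewrite !poly_actD !poly_actMX !poly_actC addrC T_lin//; last exact/S_pact/S_T.
by rewrite IH 1?addrC//; exact: S_T.
Qed.

Lemma poly_actM p q v : S v -> poly_act (p * q) v = poly_act p (poly_act q v).
Proof.
elim/poly_ind: p v => [|p c IH] v Sv; first by rewrite mul0r !poly_act0.
rewrite mulrDl poly_actD poly_actCM -mulrA (mulrC 'X) mulrA.
rewrite poly_actMX poly_actD poly_actMX poly_actC IH; last exact: S_T.
by rewrite poly_act_T.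
Qed.

Lemma poly_act_dvd p q v : S v -> p %| q ->
  poly_act p v = 0 -> poly_act q v = 0.
Proof. by move=> Sv /dvdpP[r ->] pv; rewrite poly_actM// pv poly_act_at0. Qed.

Lemma coprimep_kernel_eq0 p q v : coprimep p q -> S v ->
  poly_act p v = 0 -> poly_act q v = 0 -> v = 0.
Proof.
move=> /Bezout_eq1_coprimepP[[a b] /= ab] Sv pv qv.
rewrite -[v]scale1r -poly_actC polyC1 -ab poly_actD !poly_actM// pv qv.
by rewrite !poly_act_at0 addr0.
Qed.

(** With [a * p + b * q = 1], the components are [(b q)(T) v] and
[(a p)(T) v]. *)
Lemma coprimep_kernel_split p q v : coprimep p q -> S v ->
  poly_act (p * q) v = 0 ->
  exists v1 v2,
    [/\ S v1, S v2, v = v1 + v2, poly_act p v1 = 0 & poly_act q v2 = 0].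
Proof.
move=> /Bezout_eq1_coprimepP[[a b] /= ab] Sv pqv.
exists (poly_act (b * q) v), (poly_act (a * p) v); split; try exact: S_pact.
- by rewrite -poly_actD addrC ab -polyC1 poly_actC scale1r.
- by rewrite -poly_actM// mulrCA poly_actM// pqv poly_act_at0.
- by rewrite -poly_actM// mulrCA (mulrC q) poly_actM// pqv poly_act_at0.
Qed.

Lemma coprimep_XsubC_prod (mu : K -> nat) z rs : z \notin rs ->
  coprimep (('X - z%:P) ^+ mu z) (\prod_(y <- rs) ('X - y%:P) ^+ mu y).
Proof.
move=> zrs; apply: coprimep_expl.
elim: rs zrs => [|y rs IH]; first by rewrite big_nil coprimep1.
rewrite in_cons negb_or big_cons coprimepMr => /andP[zy zrs].
rewrite IH// andbT; apply: coprimep_expr.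
by rewrite coprimep_XsubC root_XsubC eq_sym.
Qed.

Lemma kernel_prod_XsubC (mu : K -> nat) rs v : uniq rs -> S v ->
  poly_act (\prod_(z <- rs) ('X - z%:P) ^+ mu z) v = 0 ->
  exists w : K -> V,
    [/\ forall z, z \in rs -> S (w z),
         forall z, z \in rs -> poly_act (('X - z%:P) ^+ mu z) (w z) = 0
       & v = \sum_(z <- rs) w z].
Proof.
elim: rs v => [|z rs IH] v /=.
  rewrite big_nil -polyC1 poly_actC scale1r => _ _ ->.
  by exists (fun=> 0); split=> //; rewrite big_nil.
move=> /andP[zrs urs] Sv; rewrite big_cons => pv.
have [v1 [v2 [Sv1 Sv2 -> pv1 pv2]]] :=
  coprimep_kernel_split (coprimep_XsubC_prod mu zrs) Sv pv.
have [w [Sw pw ->]] := IH v2 urs Sv2 pv2.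
have neq y : y \in rs -> (y == z) = false.
  by move=> yrs; apply: contraNF zrs => /eqP <-.
exists (fun y => if y == z then v1 else w y); split.
- by move=> y; rewrite in_cons; case: eqVneq => //= _; exact: Sw.
- by move=> y; rewrite in_cons; case: eqVneq => [->|] //= _; exact: pw.
rewrite big_cons eqxx; congr (_ + _); rewrite !big_seq.
by apply: eq_bigr => y /neq ->.
Qed.

(** The product of the other factors kills all terms of the sum but the one at
[z], hence also that one; as it is coprime to the factor at [z], [w z = 0]. *)
Lemma independent_generalized_eigenvectors (mu : K -> nat) rs (w : K -> V) :
  uniq rs -> (forall z, z \in rs -> S (w z)) ->
  (forall z, z \in rs -> poly_act (('X - z%:P) ^+ mu z) (w z) = 0) ->
  \sum_(z <- rs) w z = 0 -> forall z, z \in rs -> w z = 0.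
Proof.
move=> urs Sw pw w0 z zrs.
have prs := perm_to_rem zrs.
have urem := rem_uniq z urs.
have zrem : z \notin rem z rs by rewrite mem_rem_uniq// inE eqxx.
have memrem y : y \in rem z rs -> y \in rs by exact: mem_rem.
apply: (coprimep_kernel_eq0 (coprimep_XsubC_prod mu zrem))
  (Sw _ zrs) (pw _ zrs) _.
move: w0; rewrite (perm_big _ prs) big_cons /= => /eqP.
rewrite addr_eq0 => /eqP ->.
rewrite -sumrN poly_act_sum; last first.
  by move=> y /memrem yrs; rewrite -scaleN1r; exact/S_Z/Sw.
rewrite big_seq big1// => y yrem.
have Swy := Sw _ (memrem _ yrem).
rewrite -[- _]addr0 -scaleN1r poly_act_lin// poly_act_at0 addr0.
rewrite (@poly_act_dvd (('X - y%:P) ^+ mu y)) ?scaler0//; last exact/pw/memrem.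
by rewrite (big_rem y)//= dvdp_mulr.
Qed.

End PolynomialAction.

(** * Generalized eigenvectors *)

Section GeneralizedEigenspaces.
Context {K : closedFieldType} {V : lmodType K} (S : V -> Prop) (T : V -> V).
Hypothesis S0 : S 0.
Hypothesis S_lin : forall a u v, S u -> S v -> S (a *: u + v).
Hypothesis S_T : forall v, S v -> S (T v).
Hypothesis T_lin : forall a u v, S u -> S v -> T (a *: u + v) = a *: T u + T v.
Local Notation poly_act := (poly_act T).

(** The components are indexed by the roots of [Q]; those that vanish are
dropped, which is possible for some but not for all of them as [v <> 0]. *)
Theorem generalized_eigenvector_decomposition (Q : {poly K}) (k : nat) (v : V) :
  size Q = k.+1 ->
  [/\ S v, v <> 0 & poly_act Q v = 0] <->
  exists m : nat, [/\ (1 <= m)%N, (m <= k)%N &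
    exists (vs : 'I_m -> V) (lambda : 'I_m -> K) (p : 'I_m -> nat),
    [/\ v = \sum_(i < m) vs i,
        forall i, S (vs i) /\ vs i <> 0,
        forall i, poly_act (('X - (lambda i)%:P) ^+ p i) (vs i) = 0,
        forall i, root Q (lambda i) /\ mup (lambda i) Q = p i
      & injective lambda]].
Proof.
move=> sQ; have Q0 : Q != 0 by rewrite -size_poly_gt0 sQ.
split=> [[Sv v0 Qv]|[m [m1 mk [vs [lam [p [-> Svs pvs lamQ inj_lam]]]]]]].
  have [r Er] := closed_field_poly_normal Q.
  have lc0 : lead_coef Q != 0 by rewrite lead_coef_eq0.
  have sr : size r = k.
    by apply: succn_inj; rewrite -sQ Er size_scale// size_prod_XsubC.
  have mupE z : mup z Q = count_mem z r.
    by rewrite Er -mul_polyC mupMr ?mu_prod_XsubC// rootC.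
  pose rs := undup r.
  have Pv : poly_act (\prod_(z <- rs) ('X - z%:P) ^+ mup z Q) v = 0.
    under eq_bigr do rewrite mupE.
    rewrite prodr_undup_exp_count.
    move: Qv; rewrite Er -mul_polyC poly_actCM => /eqP.
    by rewrite scaler_eq0 (negbTE lc0) => /eqP.
  have [w [Sw pw vw]] :=
    kernel_prod_XsubC S0 S_lin S_T T_lin (undup_uniq r) Sv Pv.
  pose rs' := [seq z <- rs | `[< w z <> 0 >]].
  have vw' : v = \sum_(z <- rs') w z.
    rewrite big_filter big_mkcond vw; apply: eq_bigr => z _.
    by case: asboolP => // /contrapT.
  have sub z : z \in rs' -> z \in rs /\ w z <> 0.
    by rewrite mem_filter => /andP[/asboolP].
  exists (size rs'); split.
  - by case: rs' vw' {sub} => //; rewrite big_nil => /v0.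
  - by rewrite -sr size_filter (leq_trans (count_size _ _))// size_undup.
  have nthP (i : 'I_(size rs')) := sub _ (mem_nth 0 (ltn_ord i)).
  exists (fun i => w rs'`_i), (fun i => rs'`_i), (fun i => mup rs'`_i Q); split.
  - by rewrite vw' (big_nth 0) big_mkord.
  - by move=> i; have [irs wi] := nthP i; split => //; exact: Sw.
  - by move=> i; have [irs wi] := nthP i; exact: pw.
  - move=> i; have [irs wi] := nthP i; split=> //.
    by move: irs; rewrite mem_undup Er rootZ// root_prod_XsubC.
  - move=> i j /eqP; rewrite nth_uniq ?filter_uniq ?undup_uniq//.
    by move=> /eqP ij; exact: val_inj.
split.
- by apply: S_sum => // i _; have [] := Svs i.
- (* The independence lemma takes vectors indexed by the field, so [vs] is
     reindexed by eigenvalues; [0] is a dummy value off the [lambda i]. *)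
  pose rs := [seq lam i | i <- enum 'I_m].
  pose idx z := [pick i | lam i == z].
  pose w z := if idx z is Some i then vs i else 0.
  have idxE i : idx (lam i) = Some i.
    rewrite /idx; case: pickP => [j /eqP/inj_lam -> //|/(_ i)].
    by rewrite eqxx.
  have wE i : w (lam i) = vs i by rewrite /w idxE.
  have urs : uniq rs by rewrite map_inj_uniq ?enum_uniq.
  move=> sum0.
  have := @independent_generalized_eigenvectors _ _ S T S0 S_lin S_T T_lin
    (fun z => mup z Q) rs w urs.
  have H1 z : z \in rs -> S (w z).
    by move=> /mapP[i _ ->]; rewrite wE; have [] := Svs i.
  have H2 z : z \in rs -> poly_act (('X - z%:P) ^+ mup z Q) (w z) = 0.
    by move=> /mapP[i _ ->]; rewrite wE (lamQ i).2.
  move=> /(_ H1 H2); rewrite big_map big_enum /=.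
  under eq_bigr do rewrite wE.
  move=> /(_ sum0 (lam (Ordinal m1))); rewrite wE.
  have [_ ne0] := Svs (Ordinal m1).
  by move=> H; apply/ne0/H/map_f; rewrite mem_enum.
- rewrite (poly_act_sum S0 S_lin S_T T_lin); last first.
    by move=> i _; have [] := Svs i.
  rewrite big1// => i _; have [Si _] := Svs i.
  apply: (poly_act_dvd S0 S_lin S_T T_lin Si _ (pvs i)).
  by rewrite -(lamQ i).2 -mup_geq.
Qed.

End GeneralizedEigenspaces.

(** * The GJMS operator as a polynomial in the conformal Laplacian *)

Lemma size_gjms_poly_sub (R : realType) n k (Sc : R) (mu : R[i]) :
  (0 < k)%N ->
  size (gjms_poly n k Sc - mu%:P) = k.+1.
Proof.
move=> k0.
have sP : size (gjms_poly n k Sc) = k.+1.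
  rewrite /gjms_poly.
  under eq_bigr do rewrite -[X in 'X + X]opprK -polyCN.
  by rewrite size_prod_XsubC size_iota subn1.
by rewrite size_polyDl sP// size_polyN (leq_ltn_trans (size_polyC_leq1 _)).
Qed.

Section GJMSOperator.
Context {R : realType} {n : nat} (M : manifold R n)
        (g : pseudo_riemannian_metric M).
Hypothesis hn : (3 <= n)%N.
Hypothesis hg : einstein g.
Variable x0 : M.

(* [R[i]^o] makes the pointwise operations a complex vector space. *)
Local Notation F := (M -> R[i]^o).
Local Notation Y := (conformal_laplacian g : F -> F).

Lemma gjms_coefE i :
  @gjms_coef R n i =
  (n%:R * (n%:R - 2)) / (4 * n%:R * (n%:R - 1)) + Y_coef n i :> R.
Proof.
have n0 : (n%:R : R) != 0 by rewrite pnatr_eq0 -lt0n (leq_trans _ hn).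
have n1 : (n%:R : R) - 1 != 0.
  by rewrite subr_eq0 pnatr_eq1 neq_ltn (leq_trans _ hn) ?orbT.
by rewrite /gjms_coef /Y_coef; field; rewrite n0 n1.
Qed.

Lemma laplacian_plus_gjms i (f : M -> R[i]) :
  laplacian_plus g (@gjms_coef R n i) f =
  fun x => conformal_laplacian g f x + (Y_coef n i * scal g x0)%:C * f x.
Proof.
apply/funext => x; rewrite /conformal_laplacian /laplacian_plus gjms_coefE.
rewrite (einstein_scal_const hg x x0) mulrDl.
by rewrite (rmorphD (real_complex R)) mulrDl addrA.
Qed.

Lemma smooth0 : smooth (0 : F).
Proof. by split; exact: smoothR_cst. Qed.

Lemma smooth_scaleD (a : R[i]) (u v : F) :
  smooth u -> smooth v -> smooth (a *: u + v).
Proof. exact: smooth_lin. Qed.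

(** Constancy of the scalar curvature makes its smoothness trivial. *)
Lemma smooth_conformal_laplacian (v : F) : smooth v -> smooth (Y v).
Proof.
move=> Sv; rewrite (_ : Y v = fun x =>
  ((n%:R * (n%:R - 2)) / (4 * n%:R * (n%:R - 1)) * scal g x0)%:C * v x
  + laplacian g v x).
  exact: (smooth_lin _ Sv (smooth_laplacian g Sv)).
apply/funext => x; rewrite /conformal_laplacian /laplacian_plus addrC.
by rewrite (einstein_scal_const hg x x0).
Qed.

Lemma conformal_laplacian_lin (a : R[i]) (u v : F) : smooth u -> smooth v ->
  Y (a *: u + v) = a *: Y u + Y v.
Proof.
move=> Su Sv; apply/funext => x.
rewrite [RHS](_ : _ = a * Y u x + Y v x)//.
rewrite /conformal_laplacian /laplacian_plus.
rewrite (_ : a *: u + v = fun z => a * u z + v z)// laplacian_linear//.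
set c := _%:C; rewrite mulrDr mulrDr addrACA; congr (_ + _ + _).
by rewrite mulrCA.
Qed.

Lemma gjms_poly_act k (f : F) : smooth f ->
  gjms g k f = poly_act Y (gjms_poly n k (scal g x0)) f.
Proof.
move=> Sf; rewrite /gjms /gjms_poly.
elim: (index_iota 1 k.+1) => [|i s IH].
  by rewrite !big_nil -polyC1 poly_actC scale1r.
rewrite !big_cons /= IH laplacian_plus_gjms (poly_actM smooth0 smooth_scaleD
  smooth_conformal_laplacian conformal_laplacian_lin)//.
rewrite poly_actD poly_actC -['X]mul1r poly_actMX -polyC1 poly_actC scale1r.
by [].
Qed.

Lemma iter_Y_minus (lambda : R[i]) p (f : F) : smooth f ->
  iter p (Y_minus g lambda) f = poly_act Y (('X - lambda%:P) ^+ p) f.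
Proof.
move=> Sf; elim: p => [|p IH] /=.
  by rewrite expr0 -polyC1 poly_actC scale1r.
rewrite IH exprS (poly_actM smooth0 smooth_scaleD
  smooth_conformal_laplacian conformal_laplacian_lin)//.
rewrite poly_actD -polyCN poly_actC -['X]mul1r poly_actMX.
rewrite -polyC1 poly_actC scale1r scaleNr.
by [].
Qed.

Lemma fun_neq0P (f : F) : (exists x, f x != 0) <-> f <> 0.
Proof.
split=> [[x fx] f0|f0]; first by move: fx; rewrite f0 eqxx.
apply: contrapT => H; apply: f0; apply/funext => x; apply/eqP.
by apply/negPn/negP => fx; apply: H; exists x.
Qed.

Lemma eigenpair_poly_act k (mu : R[i]) (f : F) :
  eigenpair (gjms g k) mu f <->
  [/\ smooth f, f <> 0 & poly_act Y (gjms_poly n k (scal g x0) - mu%:P) f = 0].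
Proof.
have E : smooth f -> poly_act Y (gjms_poly n k (scal g x0) - mu%:P) f =
    fun x => gjms g k f x - mu * f x.
  by move=> Sf; rewrite poly_actD -polyCN poly_actC scaleNr gjms_poly_act.
split=> [[Sf /fun_neq0P f0 Pf]|[Sf /fun_neq0P f0 Pf]]; split=> //.
  by rewrite E//; apply/funext => x; rewrite Pf subrr.
move=> x; have := congr1 (fun h : F => h x) Pf; rewrite E//= => /eqP.
by rewrite subr_eq0 => /eqP.
Qed.

End GJMSOperator.

(* The scalar curvature of an Einstein metric is constant; the polynomial is
   formed with its value [scal g x0] at an arbitrary point [x0]. *)
Theorem theorem5p3 (R : realType) (n : nat) (hn : (3 <= n)%N)
    (M : manifold R n) (g : pseudo_riemannian_metric M) (hg : einstein g)
    (k : nat) (hk : (0 < k)%N) (x0 : M) (mu : R[i]) (f : M -> R[i]) :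
  eigenpair (gjms g k) mu f <->
  exists m : nat, [/\ (1 <= m)%N, (m <= k)%N &
    exists (fs : 'I_m -> M -> R[i]) (lambda : 'I_m -> R[i]) (p : 'I_m -> nat),
    [/\ forall x, f x = \sum_(i < m) fs i x,
        forall i, smooth (fs i) /\ exists x, fs i x != 0,
        forall i x, iter (p i) (Y_minus g (lambda i)) (fs i) x = 0,
        forall i, root_of_multiplicity (gjms_poly n k (scal g x0) - mu%:P)
                    (lambda i) (p i)
      & injective lambda]].
Proof.
rewrite (eigenpair_poly_act hn hg x0).
rewrite (generalized_eigenvector_decomposition (smooth0 M)
  (@smooth_scaleD _ _ M) (smooth_conformal_laplacian hg x0)
  (conformal_laplacian_lin g) f (size_gjms_poly_sub n (scal g x0) mu hk)).
split=> -[m [m1 mk [fs [lam [p [fE fsP pfs lamP lamI]]]]]]; exists m;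
  split=> //; exists fs, lam, p; split=> //.
- by move=> x; rewrite fE fct_sumE.
- by move=> i; have [Si /fun_neq0P] := fsP i.
- by move=> i x; have [Si _] := fsP i; rewrite (iter_Y_minus hg x0)// pfs.
- by apply/funext => x; rewrite fE fct_sumE.
- by move=> i; have [Si /fun_neq0P] := fsP i.
- by move=> i; have [Si _] := fsP i;
  rewrite -(iter_Y_minus hg x0)//; apply/funext => x; exact: pfs.
Qed.
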